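(* Let $n \geq 4$. Let $T_1$ be an $n$-leaf binary tree and $T_2$ an $n$-leaf left turn tree. Then $T_1$ and $T_2$ have a common parse word, i.e. there is a word of length $n$ on $\{0,1,2\}$ parsed by both $T_1$ and $T_2$.
   Context: A binary tree is a rooted ordered tree in which each vertex has either $0$ or $2$ children; its leaves are ordered left to right. Let $G$ be the context-free grammar with start symbols $0,1,2$ and rules $0\to 12$, $0\to 21$, $1\to 02$, $1\to 20$, $2\to 01$, $2\to 10$. An $n$-leaf binary tree $T$ parses a word $w$ of length $n$ on $\{0,1,2\}$ if there is a labeling of the vertices of $T$ by $0,1,2$ such that the leaves, from left to right, are labeled with the letters of $w$, and at every internal vertex the label of the vertex together with the labels of its left and right children form a rule of $G$ (i.e. the three labels are pairwise distinct). The level of a vertex is its distance from the root. A path tree is a binary tree with at most two vertices on each level. For $N\ge 2$, $N$-leaf path trees correspond bijectively to words $x_1\cdots x_{N-2}$ on $\{l,r\}$: $x_j=l$ (resp. $x_j=r$) means that, of the two vertices on level $j$, the left (resp. right) one has children. $\mathrm{LeftTurnTree}(p,q)$ is the $(p+q)$-leaf path tree corresponding to $l^p r^{q-2}$. An $n$-leaf left turn tree is a tree of the form $\mathrm{LeftTurnTree}(p,q)$ with $p+q=n$, where $p\ge 0$ and $q\ge 2$ are integers. *)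

(* Defs.v *)
From mathcomp Require Import all_boot zify.

Set Implicit Arguments.
Unset Strict Implicit.
Unset Printing Implicit Defensive.

Inductive bintree : Type := Leaf | Node of bintree & bintree.

Fixpoint nleaves (T : bintree) : nat :=
  if T is Node l r then nleaves l + nleaves r else 1.

Definition internal (T : bintree) : bool := if T is Node _ _ then true else false.

(* The vertices at distance [j] from the root, left to right; a vertex is
   represented by the subtree rooted at it. *)
Fixpoint level (T : bintree) (j : nat) {struct j} : seq bintree :=
  match j, T with
  | 0, _ => [:: T]
  | j'.+1, Node l r => level l j' ++ level r j'
  | _.+1, Leaf => [::]
  end.

(* [rule a b c] stands for the production a -> b c. *)
Definition rule (a b c : 'I_3) : bool :=
  (val a, val b, val c) \in
    [:: (0, 1, 2); (0, 2, 1); (1, 0, 2); (1, 2, 0); (2, 0, 1); (2, 1, 0)].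

Lemma rule_distinct (a b c : 'I_3) : rule a b c = uniq [:: a; b; c].
Proof. by case: a b c => [[|[|[|?]]] ?] [[|[|[|?]]] ?] [[|[|[|?]]] ?]. Qed.

(* Binary trees together with a labeling of all their vertices. *)
Inductive ltree : Type :=
  | LLeaf of 'I_3
  | LNode of 'I_3 & ltree & ltree.

Definition label (t : ltree) : 'I_3 :=
  match t with LLeaf a => a | LNode a _ _ => a end.

Fixpoint shape (t : ltree) : bintree :=
  if t is LNode _ l r then Node (shape l) (shape r) else Leaf.

Fixpoint leaf_labels (t : ltree) : seq 'I_3 :=
  match t with
  | LLeaf a => [:: a]
  | LNode _ l r => leaf_labels l ++ leaf_labels r
  end.

Fixpoint follows_rules (t : ltree) : bool :=
  if t is LNode a l r then
    [&& rule a (label l) (label r), follows_rules l & follows_rules r]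
  else true.

Definition parses (T : bintree) (w : seq 'I_3) : Prop :=
  exists t : ltree, [/\ shape t = T, leaf_labels t = w & follows_rules t].

Definition path_tree (T : bintree) : Prop := forall j, size (level T j) <= 2.

Inductive side : Type := lft | rgt.

(* Since x_1 is the letter of index 0, the letter of index [j] describes
   level [j.+1]. *)
Definition corresponds (T : bintree) (x : seq side) : Prop :=
  [/\ path_tree T, nleaves T = size x + 2
    & forall j, j < size x ->
        [seq internal v | v <- level T j.+1]
          = if nth lft x j is lft then [:: true; false] else [:: false; true]].

Fixpoint path_tree_of (x : seq side) : bintree :=
  match x with
  | [::] => Node Leaf Leaf
  | lft :: x' => Node (path_tree_of x') Leaf
  | rgt :: x' => Node Leaf (path_tree_of x')
  end.

Definition LeftTurnTree (p q : nat) : bintree :=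
  path_tree_of (nseq p lft ++ nseq (q - 2) rgt).

Definition left_turn_tree (n : nat) (T : bintree) : Prop :=
  exists p q : nat, [/\ 2 <= q, p + q = n & T = LeftTurnTree p q].

Lemma nleaves_gt0 (T : bintree) : 0 < nleaves T.
Proof. by elim: T => //= l Hl r _; rewrite addn_gt0 Hl. Qed.

Lemma nleaves1 (T : bintree) : nleaves T = 1 -> T = Leaf.
Proof.
by case: T => //= l r; have := nleaves_gt0 l; have := nleaves_gt0 r; lia.
Qed.

Lemma path_tree_Node (l r : bintree) :
  path_tree (Node l r) -> path_tree l /\ path_tree r.
Proof.
by move=> h; split=> j; have := h j.+1; rewrite /= size_cat; lia.
Qed.

Lemma path_tree_NodeLeaf (T : bintree) :
  path_tree T -> path_tree (Node T Leaf) /\ path_tree (Node Leaf T).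
Proof.
move=> h; split=> -[|[|j]] //=.
- by rewrite cats0; apply: (h j.+1).
- exact: (h j.+1).
Qed.

Lemma corresponds_path_tree_of (x : seq side) : corresponds (path_tree_of x) x.
Proof.
elim: x => [|s x [IHp IHn IHl]]; first by split=> // -[|[|[|j]]].
split.
- by case: s; have [] := path_tree_NodeLeaf IHp.
- by case: s; rewrite /= IHn; lia.
- move=> [_|j /IHl {}IHl]; first by case: s; case: {IHp IHn IHl} x => [|[] x].
  by rewrite /= -{}IHl; case: s; rewrite /= ?cats0.
Qed.

Lemma corresponds_unique (T : bintree) (x : seq side) :
  corresponds T x -> T = path_tree_of x.
Proof.
elim: x T => [|s x IH] [|l r] [hp hn hl]; try by move: hn => /=; lia.
  rewrite /= in hn.
  have gl := nleaves_gt0 l; have gr := nleaves_gt0 r.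
  by congr Node; apply: nleaves1; lia.
have [hpl hpr] := path_tree_Node hp.
have := hl 0 isT; case: s hn {hp} hl => /= hn hl.
- case: r hpr hn hl => [|? ?] _ /= hn hl; last by case: (l).
  move=> _; congr Node; apply: IH; split=> //; first by lia.
  by move=> j hj; have := hl j.+1 hj; rewrite /= cats0.
- case: l hpl hn hl => [|? ?] _ /= hn hl; last by case: (r).
  move=> _; congr Node; apply: IH; split=> //; first by lia.
  by move=> j hj; have := hl j.+1 hj.
Qed.

Lemma corresponds_inj (T : bintree) (x y : seq side) :
  corresponds T x -> corresponds T y -> x = y.
Proof.
move=> [_ nx lx] [_ ny ly]; have exy : size x = size y by lia.
apply: (@eq_from_nth _ lft) => // j hj.
have := lx j hj; rewrite ly -?exy //.
by case: (nth lft x j); case: (nth lft y j).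
Qed.

Lemma path_tree_corresponds (T : bintree) :
  path_tree T -> 2 <= nleaves T -> exists x, corresponds T x.
Proof.
suff H : path_tree T -> 2 <= nleaves T -> exists x, T = path_tree_of x.
  by move=> hp /(H hp) [x ->]; exists x; apply: corresponds_path_tree_of.
elim: T => //= l IHl r IHr hp _; have [hpl hpr] := path_tree_Node hp.
have := hp 2.
case: l IHl hpl {hp} => [|l1 l2] IHl hpl; case: r IHr hpr => [|r1 r2] IHr hpr //= _.
- by exists [::].
- case: (IHr hpr) => [|x ->]; last by exists (rgt :: x).
  by have := nleaves_gt0 r1; have := nleaves_gt0 r2; rewrite /=; lia.
- case: (IHl hpl) => [|x ->]; last by exists (lft :: x).
  by have := nleaves_gt0 l1; have := nleaves_gt0 l2; rewrite /=; lia.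
Qed.

(* Main.v *)
Require Import Defs.
From mathcomp Require Import all_boot.
From mathcomp Require Import zify.

(** Identify 0, 1, 2 with the nonzero elements of the Klein four-group. Then a
word is parsed by [T] iff all subtrees of [T] have nonzero leaf sum; in terms
of the prefix sums [f 0, ..., f n], iff [f] is a proper 4-colouring of the
triangulated (n+1)-gon dual to [T]. For LeftTurnTree(p, q), this polygon
consists of two fans: [f 0 <> f j] for [q <= j] and [f q <> f j] for [j < q].
It is enough to colour the triangulation dual to the other tree with [A] at 0
and nowhere on [q..n], and with [B] at q and nowhere on [0..q-1]. The triangles
with vertices on both sides form a strip, dual to the path from the root to the
q-th leaf. Give colour [A] to every other strip vertex on the left side,
starting at 0, and [B] to every other strip vertex on the right side, ending at
q: every strip triangle then has a vertex coloured [A] or [B], and the two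
other colours complete the colouring. The polygons hanging off the strip are
coloured with the three colours available on their side. *)

Set Implicit Arguments.
Unset Strict Implicit.
Unset Printing Implicit Defensive.

Definition colour : Type := (bool * bool)%type.
Definition A : colour := (false, false).
Definition B : colour := (true, true).

(* The difference [x - y], with the value at [x = y] being junk. *)
Definition diff_letter (x y : colour) : 'I_3 :=
  match x.1 (+) y.1, x.2 (+) y.2 with
  | true, true => @Ordinal 3 0 isT
  | true, false => @Ordinal 3 1 isT
  | false, _ => @Ordinal 3 2 isT
  end.

Lemma rule_diff_letter (x y z : colour) : x != y -> y != z -> x != z ->
  rule (diff_letter x z) (diff_letter x y) (diff_letter y z).
Proof. by move: x y z => [[] []] [[] []] [[] []]. Qed.

(** A subtree stands for the side or diagonal joining the two polygon vertices that bound its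
    leaves. *)
Fixpoint proper (T : bintree) (f : nat -> colour) : bool :=
  (f 0 != f (nleaves T)) &&
  if T is Node l r then proper l f && proper r (fun j => f (nleaves l + j))
  else true.

Lemma proper_ends (T : bintree) (f : nat -> colour) :
  proper T f -> f 0 != f (nleaves T).
Proof. by case: T => [|l r] /= /andP[]. Qed.

Lemma eq_proper (T : bintree) (f g : nat -> colour) :
  (forall j, j <= nleaves T -> f j = g j) -> proper T f = proper T g.
Proof.
elim: T f g => [|l IHl r IHr] f g fg /=; first by rewrite !fg.
rewrite (fg 0) // (fg (nleaves l + nleaves r)) //.
rewrite (IHl f g) => [|j hj]; last by apply: fg; rewrite /=; lia.
rewrite (IHr _ (fun j => g (nleaves l + j))) // => j hj.
by apply: fg; rewrite /=; lia.
Qed.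

Lemma proper_consecutive (T : bintree) (f : nat -> colour) (j : nat) :
  proper T f -> j < nleaves T -> f j != f j.+1.
Proof.
elim: T f j => [|l IHl r IHr] f j /=.
  by rewrite andbT; case: j.
case/and3P=> _ pl pr hj; case: (ltnP j (nleaves l)) => hjl; first exact: IHl.
have := IHr _ (j - nleaves l) pr; rewrite addnS subnKC //; apply; lia.
Qed.

Lemma proper_parses (T : bintree) (f : nat -> colour) :
  proper T f ->
  parses T (mkseq (fun j => diff_letter (f j) (f j.+1)) (nleaves T)).
Proof.
(* Induction needs the root label as well, to check the rule at the parent. *)
suff H : proper T f -> exists t,
    [/\ Defs.shape t = T,
        leaf_labels t = mkseq (fun j => diff_letter (f j) (f j.+1)) (nleaves T),
        follows_rules t & label t = diff_letter (f 0) (f (nleaves T))].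
  by case/H=> t [? ? ? _]; exists t.
elim: T f => [|l IHl r IHr] f /=; first by exists (LLeaf (diff_letter (f 0) (f 1))).
case/and3P=> h pl pr.
have [tl [sl ll fl el]] := IHl _ pl; have [tr [sr lr fr er]] := IHr _ pr.
exists (LNode (diff_letter (f 0) (f (nleaves l + nleaves r))) tl tr).
split=> //=; first by rewrite sl sr.
- rewrite ll lr /mkseq iotaD map_cat [0 + _]addnC iotaDl -map_comp.
  by congr (_ ++ _); apply: eq_map => j /=; rewrite addnS.
- rewrite fl fr !andbT el er addn0; apply: rule_diff_letter => //.
    exact: proper_ends pl.
  by have := proper_ends pr; rewrite addn0.
Qed.

Lemma proper_glue (l r : bintree) (g h : nat -> colour) :
  proper l g -> proper r h -> g (nleaves l) = h 0 -> g 0 != h (nleaves r) ->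
  exists f, [/\ proper (Node l r) f,
    forall j, j <= nleaves l -> f j = g j &
    forall j, f (nleaves l + j) = h j].
Proof.
move=> pg ph gh ne.
pose f j := if j <= nleaves l then g j else h (j - nleaves l).
have fg j : j <= nleaves l -> f j = g j by rewrite /f => ->.
have fh j : f (nleaves l + j) = h j.
  rewrite /f; case: leqP => hj; last by congr h; lia.
  have -> : j = 0 by lia.
  by rewrite addn0.
exists f; split=> //=; rewrite fh fg // ne (eq_proper fg) pg /=.
by rewrite (@eq_proper r _ h).
Qed.

Lemma third_colour (x a b : colour) :
  exists c, [/\ c != x, c != a & c != b].
Proof.
by move: x a b => [[] []] [[] []] [[] []];
  (try by exists (true, true)); (try by exists (true, false));
  (try by exists (false, true)); (try by exists (false, false)).
Qed.

(** The apex of the root triangle takes the fourth colour, other than [x], [a] and [b]; recurse on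
    both sides. *)
Lemma three_colouring (x : colour) (T : bintree) (a b : colour) :
  a != x -> b != x -> a != b ->
  exists f, [/\ proper T f, f 0 = a, f (nleaves T) = b &
    forall j, j <= nleaves T -> f j != x].
Proof.
elim: T a b => [|l IHl r IHr] a b ax bx ab.
  exists (fun j => if j is 0 then a else b); split=> //=; first by rewrite ab.
  by case.
have [c [cx ca cb]] := third_colour x a b.
have ac : a != c by rewrite eq_sym.
have [g [pg g0 gn gx]] := IHl a c ax cx ac.
have [h [ph h0 hn hx]] := IHr c b cx bx cb.
have [||f [pf fg fh]] := proper_glue pg ph; rewrite ?gn ?h0 ?g0 ?hn //.
exists f; split=> //=; rewrite ?fh ?fg // => j hj.
case: (leqP j (nleaves l)) => hjl; first by rewrite fg ?gx.
by rewrite -(subnKC (ltnW hjl)) fh hx //; lia.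
Qed.

(* The leaf [k] joins the polygon vertices [k] and [k.+1]. The alternation of
   [B] starts at this leaf, so that [m] tells whether the last vertex gets [B]. *)
Lemma strip_colouring (T : bintree) (k : nat) : k < nleaves T ->
  exists m : bool, forall a b : colour,
    a != B -> b != A -> a != b -> (b == B) = m ->
    exists f, [/\ proper T f, f 0 = a, f (nleaves T) = b, f k.+1 = B &
      forall j, j <= nleaves T -> f j != if j <= k then B else A].
Proof.
elim: T k => [|l IHl r IHr] k /= hk.
  have -> : k = 0 by lia.
  exists true => a b aB bA ab /eqP bB.
  exists (fun j => if j is 0 then a else b); split=> //=; first by rewrite ab.
  by case.
case: (ltnP k (nleaves l)) => hkl.
  have [m Hm] := IHl k hkl.
  (* The apex is on the right side, next to [b] along the strip: exactly one of [b] and its colour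
     [c] is [B]. *)
  exists (~~ m) => a b aB bA ab bm.
  have [c [cA ca cb cm]] : exists c, [/\ c != A, a != c, c != b & (c == B) = m].
    move: m a b aB bA ab bm {Hm} => [] [[] []] [[] []] //= _ _ _ _;
    (try by exists (true, true)); (try by exists (true, false));
    by exists (false, true).
  have [g [pg g0 gn gk gx]] := Hm a c aB cA ca cm.
  have [h [ph h0 hn hx]] := three_colouring r cA bA cb.
  have [||f [pf fg fh]] := proper_glue pg ph; rewrite ?gn ?h0 ?g0 ?hn //.
  exists f; split=> //=; rewrite ?fh ?fg // => j hj.
  case: (leqP j (nleaves l)) => hjl; first by rewrite fg ?gx.
  have -> : (j <= k) = false by lia.
  by rewrite -(subnKC (ltnW hjl)) fh hx //; lia.
have [m Hm] := IHr (k - nleaves l) ltac:(lia).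
(* The apex is on the left side and the right end keeps [b], so [m] is unchanged; any [c] other than
   [B], [a], [b] will do. *)
exists m => a b aB bA ab bm.
have [c [cB ac cb]] : exists c, [/\ c != B, a != c & c != b].
  have [c [? ? ?]] := third_colour B a b.
  by exists c; split=> //; rewrite eq_sym.
have [g [pg g0 gn gx]] := three_colouring l aB cB ac.
have [h [ph h0 hn hk1 hx]] := Hm c b cB bA cb bm.
have [||f [pf fg fh]] := proper_glue pg ph; rewrite ?gn ?h0 ?g0 ?hn //.
exists f; split=> //=; [by rewrite fg | by rewrite fh | |].
  by rewrite -hk1 -fh; congr (f _); lia.
move=> j hj; case: (leqP j (nleaves l)) => hjl.
  have -> : j <= k by lia.
  by rewrite fg ?gx.
have := hx (j - nleaves l) ltac:(lia).
by rewrite -fh subnKC ?leq_sub2rE // ltnW.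
Qed.

Lemma nleaves_path_tree_of (x : seq side) :
  nleaves (path_tree_of x) = (size x).+2.
Proof. by elim: x => [|[] x /= ->] //=; rewrite addnC. Qed.

Lemma proper_right_fan (k : nat) (f : nat -> colour) :
  (forall j, j < k.+2 -> f j != f j.+1) ->
  (forall j, j < k.+2 -> f j != f k.+2) ->
  proper (path_tree_of (nseq k rgt)) f.
Proof.
elim: k f => [|k IH] f hc hf /=.
  by rewrite hf // hc //= hc.
rewrite nleaves_path_tree_of size_nseq hf // hc //=.
by apply: IH => j hj; rewrite ?hc ?hf.
Qed.

(** Each [lft] cuts off the last leaf by an edge from vertex 0; after [p] of them the fan at [q]
    remains. *)
Lemma proper_left_turn (p q : nat) (f : nat -> colour) : 2 <= q ->
  (forall j, j < p + q -> f j != f j.+1) ->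
  (forall j, j < q -> f j != f q) ->
  (forall j, q <= j <= p + q -> f 0 != f j) ->
  proper (LeftTurnTree p q) f.
Proof.
case: q => [|[|k]] // _; rewrite /LeftTurnTree subn2 /=.
elim: p => [|p IH] hc hq h0 /=; first exact: proper_right_fan.
rewrite nleaves_path_tree_of size_cat !size_nseq addn0 !addn1.
rewrite h0 ?IH //=; last by lia.
- by rewrite hc //; lia.
- by move=> j hj; apply: hc; lia.
- by move=> j hj; apply: h0; lia.
Qed.

Theorem theorem13 (n : nat) (hn : 4 <= n) (T1 T2 : bintree)
    (hT1 : nleaves T1 = n) (hT2 : left_turn_tree n T2) :
  exists w : n.-tuple 'I_3, parses T1 w /\ parses T2 w.
Proof.
case: hT2 => p [q [q2 pq ->]].
have [m Hm] := @strip_colouring T1 q.-1 ltac:(lia).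
have [b [bA bm]] : exists b, b != A /\ (b == B) = m.
  by case: m {Hm}; [exists B | exists (true, false)].
have [f [pf f0 _ fq fx]] := Hm A b isT bA ltac:(by rewrite eq_sym) bm.
rewrite prednK in fq; last by lia.
have n2 : nleaves (LeftTurnTree p q) = n.
  by rewrite nleaves_path_tree_of size_cat !size_nseq; lia.
have p2 : proper (LeftTurnTree p q) f.
  apply: proper_left_turn => // [j hj|j hj|j /andP[hq hj]].
  - by apply: (proper_consecutive pf); lia.
  - have := fx j ltac:(lia); rewrite fq.
    by have -> : j <= q.-1 by lia.
  - have := fx j ltac:(lia); rewrite f0 eq_sym.
    by have -> : (j <= q.-1) = false by lia.
(* This word depends only on [f] and the number of leaves, which the two trees share. *)
exists (tcast hT1 [tuple of mkseq (fun j => diff_letter (f j) (f j.+1)) (nleaves T1)]).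
rewrite val_tcast /=; split; first exact: proper_parses.
by rewrite hT1 -n2; apply: proper_parses.
Qed.
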